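(* Suppose $\mathrm P$ is a connected Hopf monoid in set species whose elements are polytopes (each element of $\mathrm P[I]$ is a polytope in $\mathbb RI$), and whose operations are as follows for every decomposition $I=S\sqcup T$: (i) if $\mathfrak p\in\mathrm P[S]$ and $\mathfrak q\in\mathrm P[T]$, their product is the polytopal product $\mathfrak p\cdot\mathfrak q:=\mathfrak p\times\mathfrak q\in\mathrm P[I]$; (ii) if $\mathfrak p\in\mathrm P[I]$, then its maximal face in direction $\mathbf 1_S$ factors as $\mathfrak p_{\mathbf 1_S}=\mathfrak p|_S\times\mathfrak p/_S$ for polytopes $\mathfrak p|_S\in\mathrm P[S]$ and $\mathfrak p/_S\in\mathrm P[T]$, and the coproduct of $\mathfrak p$ is $\Delta_{S,T}(\mathfrak p)=(\mathfrak p|_S,\mathfrak p/_S)$. Then every polytope in $\mathrm P$ is a generalized permutahedron, and $\mathrm P$ is a Hopf submonoid of the Hopf monoid $\mathrm{GP}$ of generalized permutahedra.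
   Context: For a finite set $I$, $\mathbb R I$ is the real vector space with basis $\{e_i\}_{i\in I}$ and $\mathbb R^I$ is its dual. Polytopes are bounded and nonempty. For a polytope $\mathfrak p\subseteq\mathbb R I$ and $y\in\mathbb R^I$, $\mathfrak p_y$ is the face of $\mathfrak p$ maximizing $y$; $\mathbf 1_S(x)=\sum_{i\in S}x_i$. For $I=S\sqcup T$ we identify $\mathbb RI=\mathbb RS\times\mathbb RT$. A bijection $\sigma:I\to J$ relabels polytopes via $e_i\mapsto e_{\sigma(i)}$. The braid arrangement in $\mathbb R^I$ is the set of hyperplanes $y(i)=y(j)$, $i\neq j$. A generalized permutahedron in $\mathbb R I$ is a polytope whose normal fan is a coarsening of the fan of faces of the braid arrangement. $\mathrm{GP}[I]$ is the set of (bounded) generalized permutahedra in $\mathbb RI$; $\mathrm{GP}$ is a connected Hopf monoid in set species with product $\mathfrak p\cdot\mathfrak q=\mathfrak p\times\mathfrak q$ and coproduct $\Delta_{S,T}(\mathfrak p)=(\mathfrak p|_S,\mathfrak p/_S)$ determined by $\mathfrak p_{\mathbf 1_S}=\mathfrak p|_S\times\mathfrak p/_S$. A Hopf submonoid is a subspecies closed under the product and coproduct maps, with the inherited operations. A set species $\mathrm H$ assigns to each finite set $I$ a set $\mathrm H[I]$ and to each bijection $\sigma:I\to J$ a map $\mathrm H[\sigma]:\mathrm H[I]\to \mathrm H[J]$, functorially. A connected Hopf monoid in set species is a set species with $\mathrm H[\emptyset]=\{1\}$ a singleton, together with, for each finite set $I$ and each ordered decomposition $I=S\sqcup T$ (parts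 may be empty), maps $(x,y)\mapsto x\cdot y$ from $\mathrm H[S]\times \mathrm H[T]$ to $\mathrm H[I]$ and $z\mapsto(z|_S,z/_S)$ from $\mathrm H[I]$ to $\mathrm H[S]\times \mathrm H[T]$ such that: (Naturality) both maps commute with relabeling along bijections. (Unitality) $x\cdot1=x=1\cdot x$ and $x|_I=x=x/_\emptyset$. (Associativity) for $I=R\sqcup S\sqcup T$: $x\cdot(y\cdot z)=(x\cdot y)\cdot z$, $(w|_{R\sqcup S})|_R=w|_R$, $(w|_{R\sqcup S})/_R=(w/_R)|_S$, $w/_{R\sqcup S}=(w/_R)/_S$. (Compatibility) for $S\sqcup T=I=S'\sqcup T'$ with $A=S\cap S'$, $B=S\cap T'$, $C=T\cap S'$, $D=T\cap T'$, and $x\in \mathrm H[S]$, $y\in \mathrm H[T]$: $(x\cdot y)|_{S'}=x|_A\cdot y|_C$ and $(x\cdot y)/_{S'}=x/_A\cdot y/_C$. *)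

(* Defs.v *)
From mathcomp Require Import all_boot all_order all_algebra.
From mathcomp Require Import boolp classical_sets reals.
From mathcomp Require Import lra.

Set Implicit Arguments.
Unset Strict Implicit.
Unset Printing Implicit Defensive.

Import Order.TTheory GRing.Theory Num.Theory.
Local Open Scope classical_set_scope.
Local Open Scope ring_scope.

Record bijection (A B : Type) := Bijection {
  bij_fun :> A -> B;
  bij_funP : bijective bij_fun }.

(* An ordered decomposition I = S ⊔ T; the inclusions of the parts in I are
   [dl d] and [dr d]. Parts may be empty. *)
Definition decomp (I S T : finType) := bijection (S + T)%type I.

Definition dl (I S T : finType) (d : decomp I S T) (s : S) : I := d (inl s).
Definition dr (I S T : finType) (d : decomp I S T) (t : T) : I := d (inr t).

(* [hm_restr _ d z] and [hm_contr _ d z] stand for z|_S and z/_S. Identifications that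
   are equalities between nested subsets (R ⊆ R ⊔ S ⊆ I, A = S ∩ S', etc.)
   become commutation hypotheses between the inclusion maps. *)
Record hopfMonoid (H : finType -> Type) := HopfMonoid {
  hm_relabel : forall I J : finType, bijection I J -> H I -> H J;
  hm_one : H void;
  hm_mul : forall I S T : finType, decomp I S T -> H S -> H T -> H I;
  hm_restr : forall I S T : finType, decomp I S T -> H I -> H S;
  hm_contr : forall I S T : finType, decomp I S T -> H I -> H T;
  relabel_id : forall (I : finType) (s : bijection I I) (x : H I),
    (forall i, s i = i) -> hm_relabel s x = x;
  relabel_comp : forall (I J K : finType) (s : bijection I J)
      (t : bijection J K) (r : bijection I K) (x : H I),
    (forall i, r i = t (s i)) -> hm_relabel r x = hm_relabel t (hm_relabel s x);
  one_unique : forall x : H void, x = hm_one;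
  mul_natural : forall (I S T J S' T' : finType)
      (d : decomp I S T) (d' : decomp J S' T')
      (f : bijection I J) (g : bijection S S') (h : bijection T T')
      (x : H S) (y : H T),
    (forall s, f (dl d s) = dl d' (g s)) ->
    (forall t, f (dr d t) = dr d' (h t)) ->
    hm_relabel f (hm_mul d x y) = hm_mul d' (hm_relabel g x) (hm_relabel h y);
  restr_natural : forall (I S T J S' T' : finType)
      (d : decomp I S T) (d' : decomp J S' T')
      (f : bijection I J) (g : bijection S S') (h : bijection T T') (z : H I),
    (forall s, f (dl d s) = dl d' (g s)) ->
    (forall t, f (dr d t) = dr d' (h t)) ->
    hm_relabel g (hm_restr d z) = hm_restr d' (hm_relabel f z);
  contr_natural : forall (I S T J S' T' : finType)
      (d : decomp I S T) (d' : decomp J S' T')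
      (f : bijection I J) (g : bijection S S') (h : bijection T T') (z : H I),
    (forall s, f (dl d s) = dl d' (g s)) ->
    (forall t, f (dr d t) = dr d' (h t)) ->
    hm_relabel h (hm_contr d z) = hm_contr d' (hm_relabel f z);
  mul_one : forall (I : finType) (d : decomp I I void) (x : H I),
    (forall i, dl d i = i) -> hm_mul d x hm_one = x;
  one_mul : forall (I : finType) (d : decomp I void I) (x : H I),
    (forall i, dr d i = i) -> hm_mul d hm_one x = x;
  restr_full : forall (I : finType) (d : decomp I I void) (x : H I),
    (forall i, dl d i = i) -> hm_restr d x = x;
  contr_empty : forall (I : finType) (d : decomp I void I) (x : H I),
    (forall i, dr d i = i) -> hm_contr d x = x;
  (* Here I = Q ⊔ S ⊔ T, U = S ⊔ T and V = Q ⊔ S. *)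
  mul_assoc : forall (I Q S T U V : finType)
      (d1 : decomp I Q U) (d2 : decomp U S T)
      (d3 : decomp I V T) (d4 : decomp V Q S) (x : H Q) (y : H S) (z : H T),
    (forall r, dl d1 r = dl d3 (dl d4 r)) ->
    (forall s, dr d1 (dl d2 s) = dl d3 (dr d4 s)) ->
    (forall t, dr d1 (dr d2 t) = dr d3 t) ->
    hm_mul d1 x (hm_mul d2 y z) = hm_mul d3 (hm_mul d4 x y) z;
  restr_restr : forall (I Q S T U V : finType)
      (d1 : decomp I Q U) (d2 : decomp U S T)
      (d3 : decomp I V T) (d4 : decomp V Q S) (w : H I),
    (forall r, dl d1 r = dl d3 (dl d4 r)) ->
    (forall s, dr d1 (dl d2 s) = dl d3 (dr d4 s)) ->
    (forall t, dr d1 (dr d2 t) = dr d3 t) ->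
    hm_restr d4 (hm_restr d3 w) = hm_restr d1 w;
  contr_restr : forall (I Q S T U V : finType)
      (d1 : decomp I Q U) (d2 : decomp U S T)
      (d3 : decomp I V T) (d4 : decomp V Q S) (w : H I),
    (forall r, dl d1 r = dl d3 (dl d4 r)) ->
    (forall s, dr d1 (dl d2 s) = dl d3 (dr d4 s)) ->
    (forall t, dr d1 (dr d2 t) = dr d3 t) ->
    hm_contr d4 (hm_restr d3 w) = hm_restr d2 (hm_contr d1 w);
  contr_contr : forall (I Q S T U V : finType)
      (d1 : decomp I Q U) (d2 : decomp U S T)
      (d3 : decomp I V T) (d4 : decomp V Q S) (w : H I),
    (forall r, dl d1 r = dl d3 (dl d4 r)) ->
    (forall s, dr d1 (dl d2 s) = dl d3 (dr d4 s)) ->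
    (forall t, dr d1 (dr d2 t) = dr d3 t) ->
    hm_contr d3 w = hm_contr d2 (hm_contr d1 w);
  (* Here A = S ∩ S', B = S ∩ T', C = T ∩ S' and D = T ∩ T'. *)
  restr_mul : forall (I S T S' T' A B C D : finType)
      (d : decomp I S T) (d' : decomp I S' T')
      (a : decomp S A B) (b : decomp T C D)
      (a' : decomp S' A C) (b' : decomp T' B D) (x : H S) (y : H T),
    (forall i, dl d (dl a i) = dl d' (dl a' i)) ->
    (forall i, dl d (dr a i) = dr d' (dl b' i)) ->
    (forall i, dr d (dl b i) = dl d' (dr a' i)) ->
    (forall i, dr d (dr b i) = dr d' (dr b' i)) ->
    hm_restr d' (hm_mul d x y) = hm_mul a' (hm_restr a x) (hm_restr b y);
  contr_mul : forall (I S T S' T' A B C D : finType)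
      (d : decomp I S T) (d' : decomp I S' T')
      (a : decomp S A B) (b : decomp T C D)
      (a' : decomp S' A C) (b' : decomp T' B D) (x : H S) (y : H T),
    (forall i, dl d (dl a i) = dl d' (dl a' i)) ->
    (forall i, dl d (dr a i) = dr d' (dl b' i)) ->
    (forall i, dr d (dl b i) = dl d' (dr a' i)) ->
    (forall i, dr d (dr b i) = dr d' (dr b' i)) ->
    hm_contr d' (hm_mul d x y) = hm_mul b' (hm_contr a x) (hm_contr b y) }.

(* H is a Hopf submonoid of K, with inclusion [incl]: the image of [incl] is
   a subspecies of K closed under the product and coproduct maps of K, and the
   operations of H are those inherited from K. *)
Definition hopf_submonoid (H K : finType -> Type)
    (MH : hopfMonoid H) (MK : hopfMonoid K)
    (incl : forall I : finType, H I -> K I) : Prop :=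
  (forall I : finType, injective (@incl I)) /\
  [/\ forall (I J : finType) (f : bijection I J) (x : H I),
        incl J (hm_relabel MH f x) = hm_relabel MK f (incl I x),
      forall (I S T : finType) (d : decomp I S T) (x : H S) (y : H T),
        incl I (hm_mul MH d x y) = hm_mul MK d (incl S x) (incl T y),
      forall (I S T : finType) (d : decomp I S T) (z : H I),
        incl S (hm_restr MH d z) = hm_restr MK d (incl I z) &
      forall (I S T : finType) (d : decomp I S T) (z : H I),
        incl T (hm_contr MH d z) = hm_contr MK d (incl I z)].

(* RI, and also its dual R^I paired with it by [dot]; R^o is R seen as a
   module over itself. *)
Notation vec R I := {ffun I -> R^o}.

Section Polytopes.
Variable R : realType.
Implicit Types A B I J K Q S T U V : finType.

Definition dot I (y x : vec R I) : R := \sum_i y i * x i.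

Definition hull I J (v : J -> vec R I) : set (vec R I) :=
  [set x | exists a : J -> R,
     [/\ forall j, 0 <= a j, \sum_j a j = 1 & x = \sum_j a j *: v j]].

Definition polytope I (p : set (vec R I)) : Prop :=
  p !=set0 /\ exists (J : finType) (v : J -> vec R I), p = hull v.

Definition face I (p : set (vec R I)) (y : vec R I) :
    set (vec R I) :=
  [set x | p x /\ forall z, p z -> dot y z <= dot y x].

(* the functional 1_S on RI *)
Definition indic I S T (d : decomp I S T) : vec R I :=
  [ffun i => (i \in codom (dl d))%:R].

Definition pull (A I : finType) (f : A -> I) (x : vec R I) :
    vec R A := [ffun a => x (f a)].

(* The linear map e_i |-> e_(s i) sends x to the y such that y (s i) = x i. *)
Definition relabel_set I J (s : bijection I J) (p : set (vec R I)) :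
    set (vec R J) := [set y | p (pull s y)].

(* p × q, under the identification RI = RS × RT given by d *)
Definition prod_set I S T (d : decomp I S T)
    (p : set (vec R S)) (q : set (vec R T)) : set (vec R I) :=
  [set x | p (pull (dl d) x) /\ q (pull (dr d) x)].

(* The closed normal cone of the face q of p, and the normal fan of p: the
   nonempty faces of p are the sets [face p y]. *)
Definition normal_cone I (p q : set (vec R I)) : set (vec R I) :=
  [set y | q `<=` face p y].

Definition normal_fan I (p : set (vec R I)) : set (set (vec R I)) :=
  [set normal_cone p (face p y) | y in [set: vec R I]].

(* The closed face of the braid arrangement containing y0 in its relative
   interior: with respect to each hyperplane y i = y j it consists of the
   points weakly on the same side as y0, and on the hyperplane if y0 is. *)
Definition braid_face I (y0 : vec R I) : set (vec R I) :=
  [set y | forall i j, y0 i <= y0 j -> y i <= y j].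

Definition braid_fan I : set (set (vec R I)) :=
  [set braid_face y0 | y0 in [set: vec R I]].

Definition coarsening I (F G : set (set (vec R I))) : Prop :=
  \bigcup_(C in F) C = \bigcup_(D in G) D /\
  forall C, F C -> C = \bigcup_(D in [set D | G D /\ D `<=` C]) D.

Definition generalized_permutahedron I (p : set (vec R I)) : Prop :=
  polytope p /\ coarsening (normal_fan p) (@braid_fan I).

(* The only possible factors of the face p_{1_S}; [gp_factor] below shows that
   they are factors when p is a generalized permutahedron. *)
Definition face_restr I S T (d : decomp I S T) (p : set (vec R I)) :
    set (vec R S) := [set pull (dl d) x | x in face p (indic d)].

Definition face_contr I S T (d : decomp I S T) (p : set (vec R I)) :
    set (vec R T) := [set pull (dr d) x | x in face p (indic d)].

Lemma dotDl I (y y' x : vec R I) : dot (y + y') x = dot y x + dot y' x.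
Proof.
by rewrite -big_split; apply: eq_bigr => i _; rewrite ffunE mulrDl.
Qed.

Lemma dotDr I (y x x' : vec R I) : dot y (x + x') = dot y x + dot y x'.
Proof.
by rewrite -big_split; apply: eq_bigr => i _; rewrite ffunE mulrDr.
Qed.

Lemma dotZl I c (y x : vec R I) : dot (c *: y) x = c * dot y x.
Proof. by rewrite mulr_sumr; apply: eq_bigr => i _; rewrite ffunE mulrA. Qed.

Lemma dotZr I c (y x : vec R I) : dot y (c *: x) = c * dot y x.
Proof. by rewrite mulr_sumr; apply: eq_bigr => i _; rewrite ffunE mulrCA. Qed.

Lemma dot0l I (x : vec R I) : dot 0 x = 0.
Proof. by rewrite /dot big1 // => i _; rewrite ffunE mul0r. Qed.

Lemma dot0r I (y : vec R I) : dot y 0 = 0.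
Proof. by rewrite /dot big1 // => i _; rewrite ffunE mulr0. Qed.

Lemma dot_sumr I (J : finType) (y : vec R I) (a : J -> R)
    (v : J -> vec R I) :
  dot y (\sum_j a j *: v j) = \sum_j a j * dot y (v j).
Proof.
rewrite (big_morph (dot y) (dotDr y) (dot0r y)).
by apply: eq_bigr => j _; rewrite dotZr.
Qed.

Lemma dot_decomp I S T (d : decomp I S T) (y x : vec R I) :
  dot y x = dot (pull (dl d) y) (pull (dl d) x)
          + dot (pull (dr d) y) (pull (dr d) x).
Proof.
rewrite /dot (reindex d) /=; last exact/onW_bij/bij_funP.
by rewrite big_sumType /=; congr (_ + _); apply: eq_bigr => i _; rewrite !ffunE.
Qed.

Lemma decomp_cover I S T (d : decomp I S T) (P : I -> Prop) :
  (forall s, P (dl d s)) -> (forall t, P (dr d t)) -> forall i, P i.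
Proof.
move=> Pl Pr i; have [g _ gK] := bij_funP d.
by rewrite -(gK i); case: (g i) => [s|t]; [exact: Pl | exact: Pr].
Qed.

Lemma decomp_inj I S T (d : decomp I S T) :
  [/\ injective (dl d), injective (dr d) & forall s t, dl d s <> dr d t].
Proof.
have dI := bij_inj (bij_funP d).
by split=> [s s' /dI[]|t t' /dI[]|s t /dI].
Qed.

Lemma braid_face_decomp I S T (d : decomp I S T) (y w : vec R I) :
  (forall s s', y (dl d s) <= y (dl d s') -> w (dl d s) <= w (dl d s')) ->
  (forall s t, y (dl d s) <= y (dr d t) -> w (dl d s) <= w (dr d t)) ->
  (forall t s, y (dr d t) <= y (dl d s) -> w (dr d t) <= w (dl d s)) ->
  (forall t t', y (dr d t) <= y (dr d t') -> w (dr d t) <= w (dr d t')) ->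
  braid_face y w.
Proof.
move=> ll lr rl rr i; have [g _ gK] := bij_funP d => j.
by rewrite -(gK i) -(gK j); case: (g i) => ?; case: (g j) => ?;
  [exact: ll | exact: lr | exact: rl | exact: rr].
Qed.

Lemma glue_ex I S T (d : decomp I S T) (x : vec R S) (y : vec R T) :
  exists z : vec R I, pull (dl d) z = x /\ pull (dr d) z = y.
Proof.
have [g gK _] := bij_funP d.
exists [ffun i => match g i with inl s => x s | inr t => y t end].
by split; apply/ffunP => i; rewrite !ffunE gK.
Qed.

Lemma pull_ext I S T (d : decomp I S T) (x y : vec R I) :
  pull (dl d) x = pull (dl d) y -> pull (dr d) x = pull (dr d) y -> x = y.
Proof.
move=> /ffunP el /ffunP er; apply/ffunP.
apply: (@decomp_cover _ _ _ d (fun i => x i = y i)) => i.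
  by have := el i; rewrite !ffunE.
by have := er i; rewrite !ffunE.
Qed.

Lemma pullD (A I : finType) (f : A -> I) x y :
  pull f (x + y) = pull f x + pull f y.
Proof. by apply/ffunP => i; rewrite !ffunE. Qed.

Lemma pull_sum (A I J : finType) (f : A -> I) (a : J -> R) v :
  pull f (\sum_j a j *: v j) = \sum_j a j *: pull f (v j).
Proof.
have h0 : pull f (0 : vec R I) = 0 by apply/ffunP => i; rewrite !ffunE.
rewrite (big_morph (pull f) (pullD f) h0).
by apply: eq_bigr => j _; apply/ffunP => i; rewrite !ffunE.
Qed.

Lemma pull_indic_l I S T (d : decomp I S T) : pull (dl d) (indic d) = [ffun=> 1 : R].
Proof. by apply/ffunP => s; rewrite !ffunE codom_f. Qed.

Lemma pull_indic_r I S T (d : decomp I S T) : pull (dr d) (indic d) = 0.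
Proof.
apply/ffunP => t; rewrite !ffunE; case: codomP => // -[s] /esym.
by have [_ _ /[apply]] := decomp_inj d.
Qed.

Lemma indic_l I S T (d : decomp I S T) s : indic d (dl d s) = 1.
Proof. by have /ffunP/(_ s) := pull_indic_l d; rewrite !ffunE. Qed.

Lemma indic_r I S T (d : decomp I S T) t : indic d (dr d t) = 0.
Proof. by have /ffunP/(_ t) := pull_indic_r d; rewrite !ffunE. Qed.

(* Bartl's proof of Farkas' lemma *)
Lemma farkas I n (a : 'I_n -> vec R I) (b : vec R I) :
  (forall y, (forall k, dot y (a k) <= 0) -> dot y b <= 0) ->
  exists l : 'I_n -> R, (forall k, 0 <= l k) /\ b = \sum_k l k *: a k.
Proof.
elim: n a b => [|n IH] a b Hb.
  exists (fun=> 0); split=> //; rewrite big_ord0.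
  have /Hb : forall k : 'I_0, dot b (a k) <= 0 by case.
  move=> bb; apply/ffunP => i; rewrite ffunE.
  have sq : \sum_i b i * b i == 0.
    by rewrite eq_le bb sumr_ge0 // => j _; rewrite -expr2 sqr_ge0.
  move: sq; rewrite psumr_eq0; last by move=> j _; rewrite -expr2 sqr_ge0.
  by move=> /allP/(_ i (mem_index_enum i)); rewrite /= mulf_eq0 orbb => /eqP.
pose a' k := a (lift ord0 k).
have [H|] := pselect (forall y, (forall k, dot y (a' k) <= 0) -> dot y b <= 0).
  have [l [l0 ->]] := IH a' b H.
  exists (fun k => if unlift ord0 k is Some k' then l k' else 0); split.
    by move=> k; case: unlift.
  rewrite big_ord_recl unlift_none scale0r add0r.
  by apply: eq_bigr => k _; rewrite liftK.
move=> /existsNP[x0 /not_implyP[x0a /negP]]; rewrite -ltNge => x0b.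
set c := dot x0 (a ord0).
have c0 : 0 < c.
  rewrite ltNge; apply/negP => c0; have : dot x0 b <= 0.
    by apply: Hb => k; case: (unliftP ord0 k) => [k'|] ->; [exact: x0a|].
  by rewrite leNgt x0b.
pose u k := a' k - (dot x0 (a' k) / c) *: a ord0.
have key y (x : vec R I) : dot y (x - (dot x0 x / c) *: a ord0) =
    dot (y - (dot y (a ord0) / c) *: x0) x.
  rewrite dotDr dotDl -!scaleNr dotZr dotZl !mulNr; congr (_ - _).
  by rewrite mulrAC [RHS]mulrAC [dot x0 x * _]mulrC.
have [|l [l0 lE]] := IH u (b - (dot x0 b / c) *: a ord0).
  move=> y Hy; rewrite key; apply: Hb => k.
  case: (unliftP ord0 k) => [k'|] ->; first by rewrite -key; exact: Hy.
  by rewrite dotDl -scaleNr dotZl mulNr -/c divfK ?subrr// gt_eqF.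
exists (fun k => if unlift ord0 k is Some k' then l k'
    else dot x0 b / c - \sum_k l k * (dot x0 (a' k) / c)); split.
  move=> k; case: unlift => // ; rewrite subr_ge0.
  apply: (@le_trans _ _ 0); last by rewrite divr_ge0 // ltW.
  apply: sumr_le0 => j _; rewrite mulr_ge0_le0 //.
  by rewrite mulr_le0_ge0 // invr_ge0 ltW.
rewrite big_ord_recl unlift_none -[LHS](subrK ((dot x0 b / c) *: a ord0)) lE.
rewrite addrC scalerBl -addrA; congr (_ + _); rewrite scaler_suml addrC -sumrB.
by apply: eq_bigr => k _; rewrite liftK /u scalerBr scalerA.
Qed.

Lemma polytope_sep I (p : set (vec R I)) (z : vec R I) :
  polytope p -> (forall y, exists2 x, p x & dot y z <= dot y x) -> p z.
Proof.
move=> [_ [J [v ->]]] Hz.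
pose d : decomp (I + unit)%type I unit :=
  Bijection (@Bijective _ _ id id (fun=> erefl) (fun=> erefl)).
pose e (x : vec R I) : vec R (I + unit)%type :=
  [ffun o => if o is inl i then x i else 1].
have el x : pull (dl d) (e x) = x by apply/ffunP => i; rewrite !ffunE.
have er x : pull (dr d) (e x) = [ffun=> 1 : R] by apply/ffunP => i; rewrite !ffunE.
have [|l [l0 lE]] := @farkas _ #|J| (fun k => e (v (enum_val k))) (e z).
  move=> y Hy; rewrite (dot_decomp d) el er.
  have [x [a [a0 a1 ->]]] := Hz (pull (dl d) y).
  rewrite -(lerD2r (dot (pull (dr d) y) [ffun=> 1 : R])) => /le_trans; apply.
  set t := dot _ [ffun=> _]; rewrite dot_sumr -[t]mul1r -a1 mulr_suml -big_split /=.
  apply: sumr_le0 => j _; rewrite -mulrDr mulr_ge0_le0 //.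
  by have := Hy (enum_rank j); rewrite (dot_decomp d) el er enum_rankK -/t.
exists (fun j => l (enum_rank j)); split=> [j||]; first exact: l0.
  move: lE => /ffunP/(_ (inr tt)); rewrite ffunE sum_ffunE => ->.
  rewrite (reindex (@enum_val J predT)) /=; last first.
    by apply: onW_bij; exact: enum_val_bij.
  by apply: eq_bigr => k _; rewrite enum_valK !ffunE /GRing.scale/= mulr1.
rewrite -[LHS]el lE pull_sum (reindex (@enum_val J predT)) /=; last first.
  by apply: onW_bij; exact: enum_val_bij.
by apply: eq_bigr => k _; rewrite enum_valK el.
Qed.

Lemma hull_reindex I J K (f : K -> J) (v : J -> vec R I) :
  hull (v \o f) `<=` hull v.
Proof.
move=> x [a [a0 a1 ->]]; exists (fun j => \sum_(k | f k == j) a k); split.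
- by move=> j; apply: sumr_ge0.
- by rewrite -a1 (partition_big f xpredT).
- rewrite (partition_big f xpredT) //=; apply: eq_bigr => j _.
  by rewrite scaler_suml; apply: eq_bigr => k /eqP <-.
Qed.

Lemma hull_vertex I J (v : J -> vec R I) j : hull v (v j).
Proof.
exists (fun k => (k == j)%:R); split=> [k||]; first exact: ler0n.
  by rewrite (bigD1 j) //= eqxx big1 ?addr0 // => k /negPf ->.
rewrite (bigD1 j) //= eqxx scale1r big1 ?addr0 // => k /negPf ->.
by rewrite scale0r.
Qed.

Lemma polytope_face I (p : set (vec R I)) y : polytope p -> polytope (face p y).
Proof.
move=> [[x0 px0] [J [v pE]]]; have [j0 _] : exists j0 : J, true.
  move: px0; rewrite pE => -[a [_ a1 _]]; case: (pickP (@predT J)) => [j _|J0].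
    by exists j.
  by move: a1; rewrite big_pred0 // => /esym/eqP; rewrite oner_eq0.
have [m mP] : exists m, forall j, dot y (v j) <= dot y (v m).
  by case: (@arg_maxP _ _ _ j0 predT (fun j => dot y (v j))) => // m _ mP;
    exists m => j; exact: mP.
have pm z : p z -> dot y z <= dot y (v m).
  rewrite pE => -[a [a0 a1 ->]]; rewrite dot_sumr.
  rewrite -[leRHS]mul1r -a1 mulr_suml; apply: ler_sum => j _.
  by rewrite ler_wpM2l.
have pvm : p (v m) by rewrite pE; exact: hull_vertex.
split; first by exists (v m).
pose f j := if dot y (v j) == dot y (v m) then j else m.
exists J, (v \o f); apply/seteqP; split=> x.
  move=> [+ /(_ _ pvm)]; rewrite pE => -[a [a0 a1 ->]] xm.
  exists a; split=> //; apply: eq_bigr => j _ /=; rewrite /f.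
  case: eqP => // /eqP jm; suff -> : a j = 0 by rewrite !scale0r.
  have : \sum_j a j * (dot y (v m) - dot y (v j)) == 0.
    rewrite eq_le sumr_ge0 ?andbT; last first.
      by move=> k _; rewrite mulr_ge0 // subr_ge0.
    under eq_bigr do rewrite mulrBr; rewrite sumrB -mulr_suml a1 mul1r.
    by rewrite subr_le0 -dot_sumr.
  rewrite psumr_eq0; last by move=> k _; rewrite mulr_ge0 // subr_ge0.
  move=> /allP/(_ j (mem_index_enum j)) /=.
  by rewrite mulf_eq0 subr_eq0 [_ == dot y (v j)]eq_sym (negPf jm) orbF => /eqP.
move=> xf; split; first by rewrite pE; exact: hull_reindex xf.
move=> z /pm/le_trans; apply; case: xf => a [a0 a1 ->].
rewrite dot_sumr -[leLHS]mul1r -a1 mulr_suml; apply: ler_sum => j _.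
by rewrite ler_wpM2l //= /f; case: eqP => [->|].
Qed.

Lemma polytope_pull A I (f : A -> I) (p : set (vec R I)) :
  polytope p -> polytope [set pull f x | x in p].
Proof.
move=> [[x0 px0] [J [v pE]]]; split; first by exists (pull f x0), x0.
exists J, (fun j => pull f (v j)); rewrite pE; apply/seteqP; split=> y.
  by move=> [_ [a [a0 a1 ->]] <-]; exists a; split=> //; rewrite pull_sum.
move=> [a [a0 a1 ->]]; exists (\sum_j a j *: v j); last by rewrite pull_sum.
by exists a; split.
Qed.

Lemma polytope_prod I S T (d : decomp I S T) p q :
  polytope p -> polytope q -> polytope (prod_set d p q).
Proof.
move=> [[x px] [J [v pE]]] [[y qy] [K [w qE]]]; split.
  by have [z [zx zy]] := glue_ex d x y; exists z; rewrite /prod_set /= zx zy.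
have /choice[g gP] : forall jk : J * K, exists z,
    pull (dl d) z = v jk.1 /\ pull (dr d) z = w jk.2.
  by move=> jk; exact: glue_ex.
exists (J * K)%type, g; rewrite pE qE; apply/seteqP; split=> z.
  move=> [[a [a0 a1 za]] [b [b0 b1 zb]]].
  exists (fun jk => a jk.1 * b jk.2); split=> [jk||].
  - exact: mulr_ge0.
  - rewrite -(pair_bigA _ (fun j k => a j * b k)) /= -a1.
    by apply: eq_bigr => j _; rewrite -mulr_sumr b1 mulr1.
  - apply: (pull_ext (d := d)); rewrite pull_sum.
    + under eq_bigr do rewrite (gP _).1.
      rewrite -(pair_bigA _ (fun j k => (a j * b k) *: v j)) /= za.
      by apply: eq_bigr => j _; rewrite -scaler_suml -mulr_sumr b1 mulr1.
    + under eq_bigr do rewrite (gP _).2.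
      rewrite -(pair_bigA _ (fun j k => (a j * b k) *: w k)) /= zb exchange_big.
      by apply: eq_bigr => k _; rewrite -scaler_suml -mulr_suml a1 mul1r.
move=> [c [c0 c1 ->]]; split; rewrite /= pull_sum.
  under eq_bigr do rewrite (gP _).1; exists (fun j => \sum_k c (j, k)); split.
  - by move=> j; apply: sumr_ge0.
  - by rewrite -c1 pair_big; apply: eq_bigr => -[].
  - under [RHS]eq_bigr do rewrite scaler_suml.
    by rewrite pair_big; apply: eq_bigr => -[].
under eq_bigr do rewrite (gP _).2; exists (fun k => \sum_j c (j, k)); split.
- by move=> j; apply: sumr_ge0.
- by rewrite -c1 exchange_big pair_big; apply: eq_bigr => -[].
- under [RHS]eq_bigr do rewrite scaler_suml.
  by rewrite exchange_big pair_big; apply: eq_bigr => -[].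
Qed.

Lemma face_prod I S T (d : decomp I S T) p q (y : vec R I) :
  face (prod_set d p q) y =
  prod_set d (face p (pull (dl d) y)) (face q (pull (dr d) y)).
Proof.
apply/seteqP; split=> x [].
  move=> [px qx] xm; split; split=> // z Hz.
    have [u [ul ur]] := glue_ex d z (pull (dr d) x).
    have /xm : prod_set d p q u by rewrite /prod_set /= ul ur.
    by rewrite !(dot_decomp d y) ul ur lerD2r.
  have [u [ul ur]] := glue_ex d (pull (dl d) x) z.
  have /xm : prod_set d p q u by rewrite /prod_set /= ul ur.
  by rewrite !(dot_decomp d y) ul ur lerD2l.
move=> [px xl] [qx xr]; split=> // z [pz qz].
by rewrite !(dot_decomp d y) lerD ?xl ?xr.
Qed.

Lemma face0 I (p : set (vec R I)) : face p 0 = p.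
Proof.
by apply/seteqP; split=> [x []//|x px]; split=> // z _; rewrite !dot0l.
Qed.

Lemma prod_set_inj I S T (d : decomp I S T) (p p' : set (vec R S))
    (q q' : set (vec R T)) :
  p !=set0 -> q !=set0 -> prod_set d p q = prod_set d p' q' ->
  p = p' /\ q = q'.
Proof.
move=> [x0 px0] [y0 qy0] E.
have key x y : p x /\ q y <-> p' x /\ q' y.
  have [u [<- <-]] := glue_ex d x y.
  by move/seteqP: E => [E1 E2]; split=> [/E1|/E2].
have [px0' qy0'] : p' x0 /\ q' y0 by exact/key.
split; apply/seteqP; split=> z Hz.
- by have [] : p' z /\ q' y0 by exact/key.
- by have [] : p z /\ q y0 by exact/key.
- by have [] : p' x0 /\ q' z by exact/key.
- by have [] : p x0 /\ q z by exact/key.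
Qed.

Lemma face_sub_face I (p : set (vec R I)) y w :
  face p w !=set0 -> face p w `<=` face p y -> face (face p y) w = face p w.
Proof.
move=> [x0 x0p] s; apply/seteqP; split=> x.
  move=> [[px _] xm]; split=> // z pz.
  by apply: le_trans (xm _ (s _ x0p)); exact: x0p.2.
by move=> xw; split; [exact: s | move=> z [pz _]; exact: xw.2].
Qed.

Lemma face_face I (p : set (vec R I)) y w :
  face p y `&` face p w !=set0 ->
  face (face p y) w = face p y `&` face p w.
Proof.
move=> [x0 [x0y x0w]]; apply/seteqP; split=> x [xy xw].
  split=> //; split=> [|z pz]; first exact: xy.1.
  by apply: le_trans (xw _ x0y); exact: x0w.2.
by split=> // z [pz _]; exact: xw.2.
Qed.

Lemma gpP I (p : set (vec R I)) :
  generalized_permutahedron p <->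
  polytope p /\ (forall y y', braid_face y y' -> face p y `<=` face p y').
Proof.
split=> -[pP H]; split=> //.
  move=> y y' yy'; have [_ /(_ (normal_cone p (face p y)))] := H.
  have /[swap] /[apply] E : normal_fan p (normal_cone p (face p y)) by exists y.
  have : normal_cone p (face p y) y by move=> x.
  rewrite {1}E => -[_ [[z _ <-] sub] zy].
  by apply: sub => i j /zy; exact: yy'.
have fanT (F : set (set (vec R I))) :
    (forall y, exists2 C, F C & C y) -> \bigcup_(C in F) C = setT.
  move=> h; apply/seteqP; split=> // y _; have [C FC Cy] := h y.
  by exists C.
split.
  rewrite fanT; last by move=> y; exists (normal_cone p (face p y)); [exists y|].
  by rewrite fanT // => y; exists (braid_face y); [exists y|].
move=> _ [y _ <-]; apply/seteqP; split=> [z yz|z [D [_ sub]] /sub//].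
exists (braid_face z) => //; split; first by exists z.
by move=> w zw x /yz; exact: H.
Qed.

Lemma gp_full I S T (d : decomp I S T) (p : set (vec R I)) :
  generalized_permutahedron p -> (T -> False) -> face p (indic d) = p.
Proof.
move=> /gpP[_ H] T0; apply/seteqP; split=> [x []//|].
rewrite -{1}(face0 p); apply: H => i j _.
have h k : indic d k = 1.
  by move: k; apply: decomp_cover => [s|/T0//]; exact: indic_l.
by rewrite !h.
Qed.

Lemma vec_bound A (x : vec R A) : exists2 c : R, 0 < c & forall i, `|x i| < c.
Proof.
exists (1 + \sum_i `|x i|).
  by apply: ltr_pwDl => //; apply: sumr_ge0 => i _; exact: normr_ge0.
move=> i; rewrite (bigD1 i) //= addrCA.
by rewrite ltrDl ltr_pwDl // sumr_ge0.
Qed.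

Lemma face_shift I (p : set (vec R I)) y w c :
  face (face p y) (w + c *: y) = face (face p y) w.
Proof.
have const x z : face p y x -> face p y z -> dot y x = dot y z.
  by move=> [px xm] [pz zm]; apply/eqP; rewrite eq_le xm ?zm.
by apply/seteqP; split=> x [xp xm]; split=> // z zp; have := xm _ zp;
  rewrite !dotDl !dotZl (const _ _ zp xp) lerD2r.
Qed.

Lemma gp_face_indic I S T (d : decomp I S T) (p : set (vec R I)) u u' :
  generalized_permutahedron p ->
  braid_face (pull (dl d) u) (pull (dl d) u') ->
  braid_face (pull (dr d) u) (pull (dr d) u') ->
  face (face p (indic d)) u `<=` face (face p (indic d)) u'.
Proof.
move=> /gpP[pP H] ul ur.
have [b b0 ub] := vec_bound u; have [b' b'0 ub'] := vec_bound u'.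
pose c := (b + b') *+ 2.
have bnd i : - (b + b') < u i < b + b' /\ - (b + b') < u' i < b + b'.
  by move: (ub i) (ub' i); rewrite !ltr_norml => /andP[? ?] /andP[? ?]; lra.
have hl (v : vec R I) s : (v + c *: indic d) (dl d s) = v (dl d s) + c.
  by rewrite ffunE [X in _ + X]ffunE indic_l [_ *: _]mulr1.
have hr (v : vec R I) t : (v + c *: indic d) (dr d t) = v (dr d t).
  by rewrite ffunE [X in _ + X]ffunE indic_r scaler0 addr0.
have wi (v : vec R I) : (forall i, - (b + b') < v i < b + b') ->
    face p (v + c *: indic d) `<=` face p (indic d).
  move=> vb; apply: H; apply: (braid_face_decomp (d := d)) => i j;
    rewrite ?hl ?hr ?indic_l ?indic_r ?lexx ?ler01 //.
  by have := vb (dl d i); have := vb (dr d j); rewrite /c; lra.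
have fw (v : vec R I) : (forall i, - (b + b') < v i < b + b') ->
    face (face p (indic d)) v = face p (v + c *: indic d).
  move=> vb; rewrite -(face_shift p (indic d) v c) face_sub_face //; last exact: wi.
  by have [] := polytope_face (v + c *: indic d) pP.
rewrite !fw; [|by move=> i; case: (bnd i)..].
apply: H; apply: (braid_face_decomp (d := d)) => i j; rewrite ?hl ?hr.
- by rewrite !lerD2r; have := ul i j; rewrite !ffunE.
- have [] := bnd (dl d i); have [] := bnd (dr d j); rewrite /c; lra.
- have [] := bnd (dr d i); have [] := bnd (dl d j); rewrite /c; lra.
- by have := ur i j; rewrite !ffunE.
Qed.

Lemma gp_factor I S T (d : decomp I S T) (p : set (vec R I)) :
  generalized_permutahedron p ->
  face p (indic d) = prod_set d (face_restr d p) (face_contr d p).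
Proof.
move=> gp; apply/seteqP; split=> [x xp|z []]; first by split; exists x.
move=> [a aq al] [b bq br].
have qP := polytope_face (indic d) gp.1.
apply: polytope_sep => // y; have [[x xy] _] := polytope_face y qP.
exists x; first exact: xy.1.
have [u [ul ur]] := glue_ex d (pull (dl d) y) 0.
have [w [wl wr]] := glue_ex d 0 (pull (dr d) y).
have xu : face (face p (indic d)) u x.
  by apply: gp_face_indic xy; rewrite // ?ul ?ur // => i j _; rewrite !ffunE.
have xw : face (face p (indic d)) w x.
  by apply: gp_face_indic xy; rewrite // ?wl ?wr // => i j _; rewrite !ffunE.
have := xu.2 _ aq; have := xw.2 _ bq.
rewrite !(dot_decomp d u) !(dot_decomp d w) !(dot_decomp d y).
by rewrite ul ur wl wr al br !dot0l; lra.
Qed.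

Lemma face_factor_neq0 I S T (d : decomp I S T) (p : set (vec R I)) :
  polytope p -> face_restr d p !=set0 /\ face_contr d p !=set0.
Proof.
move=> /(polytope_face (indic d))[[x xp] _].
by split; [exists (pull (dl d) x), x | exists (pull (dr d) x), x].
Qed.

Lemma gp_factor_unique I S T (d : decomp I S T) (p : set (vec R I)) a b :
  polytope p -> face p (indic d) = prod_set d a b ->
  face_restr d p = a /\ face_contr d p = b.
Proof.
move=> pP E; have [[x xp] _] := polytope_face (indic d) pP.
rewrite /face_restr /face_contr E; move: xp; rewrite E => -[ax bx].
split; apply/seteqP; split=> z.
- by move=> [u [au _] <-].
- by move=> az; have [u [ul ur]] := glue_ex d z (pull (dr d) x);
    exists u; rewrite /prod_set /= ?ul ?ur.
- by move=> [u [_ bu] <-].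
- by move=> bz; have [u [ul ur]] := glue_ex d (pull (dl d) x) z;
    exists u; rewrite /prod_set /= ?ul ?ur.
Qed.

Lemma gp_prod I S T (d : decomp I S T) (p : set (vec R S)) (q : set (vec R T)) :
  generalized_permutahedron p -> generalized_permutahedron q ->
  generalized_permutahedron (prod_set d p q).
Proof.
move=> /gpP[pP Hp] /gpP[qP Hq]; apply/gpP; split; first exact: polytope_prod.
move=> y y' yy'; rewrite !face_prod => x [px qx]; split.
  by apply: Hp px => i j; rewrite !ffunE; exact: yy'.
by apply: Hq qx => i j; rewrite !ffunE; exact: yy'.
Qed.

Lemma gp_restr I S T (d : decomp I S T) (p : set (vec R I)) :
  generalized_permutahedron p -> generalized_permutahedron (face_restr d p).
Proof.
move=> gp; have pP := gp.1; apply/gpP; split.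
  exact/polytope_pull/polytope_face.
move=> y y' yy' x xy; have [_ [b bq]] := face_factor_neq0 d pP.
have [u [ul ur]] := glue_ex d y 0; have [u' [ul' ur']] := glue_ex d y' 0.
have [z [zl zr]] := glue_ex d x b.
have : face (face p (indic d)) u `<=` face (face p (indic d)) u'.
  by apply: gp_face_indic; rewrite // ?ul ?ur ?ul' ?ur' // => i j _; rewrite !ffunE.
rewrite gp_factor // !face_prod ul ur ul' ur' !face0 => /(_ z).
by rewrite /prod_set /= zl zr => -[].
Qed.

Lemma gp_contr I S T (d : decomp I S T) (p : set (vec R I)) :
  generalized_permutahedron p -> generalized_permutahedron (face_contr d p).
Proof.
move=> gp; have pP := gp.1; apply/gpP; split.
  exact/polytope_pull/polytope_face.
move=> y y' yy' x xy; have [[b bq] _] := face_factor_neq0 d pP.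
have [u [ul ur]] := glue_ex d 0 y; have [u' [ul' ur']] := glue_ex d 0 y'.
have [z [zl zr]] := glue_ex d b x.
have : face (face p (indic d)) u `<=` face (face p (indic d)) u'.
  by apply: gp_face_indic; rewrite // ?ul ?ur ?ul' ?ur' // => i j _; rewrite !ffunE.
rewrite gp_factor // !face_prod ul ur ul' ur' !face0 => /(_ z).
by rewrite /prod_set /= zl zr => -[].
Qed.

Lemma relabel_inv I J (s : bijection I J) :
  exists g : J -> I, [/\ cancel s g, cancel g s,
    forall x : vec R I, pull s (pull g x) = x &
    forall x : vec R J, pull g (pull s x) = x].
Proof.
have [g sK gK] := bij_funP s; exists g; split=> // x;
  by apply/ffunP => i; rewrite !ffunE ?sK ?gK.
Qed.

Lemma dot_pull I J (s : bijection I J) (y x : vec R J) :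
  dot (pull s y) (pull s x) = dot y x.
Proof.
rewrite [RHS](reindex s) /=; last exact/onW_bij/bij_funP.
by apply: eq_bigr => i _; rewrite !ffunE.
Qed.

Lemma face_relabel I J (s : bijection I J) (p : set (vec R I)) y :
  face (relabel_set s p) y = relabel_set s (face p (pull s y)).
Proof.
have [g [_ _ sg _]] := relabel_inv s.
apply/seteqP; split=> x [px xm]; split=> // z pz.
  by rewrite -[z]sg !dot_pull xm // /relabel_set /= sg.
by rewrite -!(dot_pull s) xm.
Qed.

Lemma gp_relabel I J (s : bijection I J) (p : set (vec R I)) :
  generalized_permutahedron p -> generalized_permutahedron (relabel_set s p).
Proof.
move=> /gpP[pP H]; apply/gpP; split.
  have [g [_ _ sg gs]] := relabel_inv s.
  rewrite (_ : relabel_set s p = [set pull g x | x in p]).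
    exact: polytope_pull.
  apply/seteqP; split=> x; first by move=> px; exists (pull s x).
  by move=> [z pz <-]; rewrite /relabel_set /= sg.
move=> y y' yy'; rewrite !face_relabel => x; apply: H => i j.
by rewrite !ffunE; exact: yy'.
Qed.

Lemma gp_void : generalized_permutahedron [set: vec R void].
Proof.
have E (x y : vec R void) : x = y by apply/ffunP => -[].
apply/gpP; split.
  split; first by exists 0.
  exists unit, (fun=> 0); apply/seteqP; split=> x // _.
  by rewrite (E x 0); exact: (@hull_vertex _ _ (fun=> 0) tt).
by move=> y y' _ x _; split=> // z _; rewrite (E z x).
Qed.

Lemma pull_pull A B J I (f : A -> B) (g : B -> I) (f' : A -> J) (g' : J -> I)
    (x : vec R I) :
  (forall a, g (f a) = g' (f' a)) -> pull f (pull g x) = pull f' (pull g' x).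
Proof. by move=> E; apply/ffunP => a; rewrite !ffunE E. Qed.

Lemma prod_set_assoc I Q S T U V (d1 : decomp I Q U) (d2 : decomp U S T)
    (d3 : decomp I V T) (d4 : decomp V Q S)
    (x : set (vec R Q)) (y : set (vec R S)) (z : set (vec R T)) :
  (forall r, dl d1 r = dl d3 (dl d4 r)) ->
  (forall s, dr d1 (dl d2 s) = dl d3 (dr d4 s)) ->
  (forall t, dr d1 (dr d2 t) = dr d3 t) ->
  prod_set d1 x (prod_set d2 y z) = prod_set d3 (prod_set d4 x y) z.
Proof.
move=> h1 h2 h3; rewrite /prod_set; apply/seteqP.
have e1 u : pull (dl d1) u = pull (dl d4) (pull (dl d3) u).
  by apply/ffunP => i; rewrite !ffunE h1.
have e3 u : pull (dr d2) (pull (dr d1) u) = pull (dr d3) u.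
  by apply/ffunP => i; rewrite !ffunE h3.
by split=> u /=; rewrite e1 e3 (pull_pull u h2); tauto.
Qed.

Lemma prod_set_swap I S T S' T' A B (C D : finType) (d : decomp I S T) (d' : decomp I S' T')
    (a : decomp S A B) (b : decomp T C D)
    (a' : decomp S' A C) (b' : decomp T' B D)
    (w : set (vec R A)) (x : set (vec R B))
    (y : set (vec R C)) (z : set (vec R D)) :
  (forall i, dl d (dl a i) = dl d' (dl a' i)) ->
  (forall i, dl d (dr a i) = dr d' (dl b' i)) ->
  (forall i, dr d (dl b i) = dl d' (dr a' i)) ->
  (forall i, dr d (dr b i) = dr d' (dr b' i)) ->
  prod_set d (prod_set a w x) (prod_set b y z) =
  prod_set d' (prod_set a' w y) (prod_set b' x z).
Proof.
move=> h1 h2 h3 h4; rewrite /prod_set; apply/seteqP.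
split=> u /=; rewrite (pull_pull u h1) (pull_pull u h2);
  by rewrite (pull_pull u h3) (pull_pull u h4) => -[[? ?] [? ?]].
Qed.

Lemma relabel_prod_set I S T J S' T' (d : decomp I S T) (d' : decomp J S' T')
    (f : bijection I J) (g : bijection S S') (h : bijection T T')
    (x : set (vec R S)) (y : set (vec R T)) :
  (forall s, f (dl d s) = dl d' (g s)) ->
  (forall t, f (dr d t) = dr d' (h t)) ->
  relabel_set f (prod_set d x y) =
  prod_set d' (relabel_set g x) (relabel_set h y).
Proof.
move=> hg hh; rewrite /relabel_set /prod_set; apply/seteqP.
by split=> u /=; rewrite (pull_pull u hg) (pull_pull u hh).
Qed.

Lemma face_coassoc I Q S T U V (d1 : decomp I Q U) (d2 : decomp U S T)
    (d3 : decomp I V T) (d4 : decomp V Q S) (p : set (vec R I)) :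
  generalized_permutahedron p ->
  (forall r, dl d1 r = dl d3 (dl d4 r)) ->
  (forall s, dr d1 (dl d2 s) = dl d3 (dr d4 s)) ->
  (forall t, dr d1 (dr d2 t) = dr d3 t) ->
  [/\ face_restr d4 (face_restr d3 p) = face_restr d1 p,
      face_contr d4 (face_restr d3 p) = face_restr d2 (face_contr d1 p) &
      face_contr d3 p = face_contr d2 (face_contr d1 p)].
Proof.
move=> gp h1 h2 h3; have [pP H] := (gpP p).1 gp.
have vals i : [\/ indic d1 i = 1 /\ indic d3 i = 1,
    indic d1 i = 0 /\ indic d3 i = 1 | indic d1 i = 0 /\ indic d3 i = 0].
  move: i; apply: (@decomp_cover _ _ _ d3) => [|t]; last first.
    by constructor 3; rewrite indic_r -h3 indic_r.
  apply: (@decomp_cover _ _ _ d4) => [r|s].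
    by constructor 1; rewrite indic_l -h1 indic_l.
  by constructor 2; rewrite indic_l -h2 indic_r.
pose w := indic d1 + indic d3.
have wE i : w i = indic d1 i + indic d3 i by rewrite ffunE.
have [w1 w3] : braid_face w (indic d1) /\ braid_face w (indic d3).
  split=> i j; rewrite !wE;
  by case: (vals i) => -[-> ->]; case: (vals j) => -[-> ->]; lra.
have [[x xw] _] := polytope_face w pP.
have E : face (face p (indic d3)) (indic d1) =
         face (face p (indic d1)) (indic d3).
  have x1 := H _ _ w1 _ xw; have x3 := H _ _ w3 _ xw.
  by rewrite !face_face 1?setIC //; exists x.
have l31 : pull (dl d3) (indic d1) = indic d4.
  apply/ffunP; apply: (@decomp_cover _ _ _ d4) => [r|s]; rewrite ffunE.
    by rewrite -h1 !indic_l.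
  by rewrite -h2 !indic_r.
have r31 : pull (dr d3) (indic d1) = 0.
  by apply/ffunP => t; rewrite ffunE -h3 indic_r ffunE.
have l13 : pull (dl d1) (indic d3 + (-1) *: indic d1) = 0.
  apply/ffunP => r; rewrite ffunE [LHS]ffunE [X in _ + X]ffunE indic_l h1.
  by rewrite indic_l [_ *: _]mulr1 subrr ffunE.
have r13 : pull (dr d1) (indic d3 + (-1) *: indic d1) = indic d2.
  apply/ffunP => i; rewrite ffunE [LHS]ffunE [X in _ + X]ffunE indic_r scaler0.
  rewrite addr0; move: i; apply: (@decomp_cover _ _ _ d2) => [s|t].
    by rewrite h2 !indic_l.
  by rewrite h3 !indic_r.
have gA := gp_restr d3 gp; have gC := gp_contr d1 gp.
move: E; rewrite -(face_shift p (indic d1) _ (-1)) !(gp_factor _ gp) !face_prod.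
rewrite l31 r31 l13 r13 !face0 (gp_factor d4 gA) (gp_factor d2 gC).
rewrite (prod_set_assoc _ _ _ h1 h2 h3).
have [A0 C0] := face_factor_neq0 d3 pP.
have [AA0 AC0] := face_factor_neq0 d4 gA.1.
have [[a Aa] [b Ab]] := (AA0, AC0).
have [x' [xa xb]] := glue_ex d4 a b.
move=> /prod_set_inj[| |E EC] //.
  by exists x'; rewrite /prod_set /= xa xb.
by have [//|//|EA EB] := prod_set_inj _ _ E; split.
Qed.

Lemma face_compat I S T S' T' A B (C D : finType) (d : decomp I S T)
    (d' : decomp I S' T') (a : decomp S A B) (b : decomp T C D)
    (a' : decomp S' A C) (b' : decomp T' B D)
    (p : set (vec R S)) (q : set (vec R T)) :
  generalized_permutahedron p -> generalized_permutahedron q ->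
  (forall i, dl d (dl a i) = dl d' (dl a' i)) ->
  (forall i, dl d (dr a i) = dr d' (dl b' i)) ->
  (forall i, dr d (dl b i) = dl d' (dr a' i)) ->
  (forall i, dr d (dr b i) = dr d' (dr b' i)) ->
  face_restr d' (prod_set d p q) =
    prod_set a' (face_restr a p) (face_restr b q) /\
  face_contr d' (prod_set d p q) =
    prod_set b' (face_contr a p) (face_contr b q).
Proof.
move=> gp gq h1 h2 h3 h4; apply: gp_factor_unique.
  exact: polytope_prod gp.1 gq.1.
have il : pull (dl d) (indic d') = indic a.
  apply/ffunP; apply: (@decomp_cover _ _ _ a) => i; rewrite ffunE.
    by rewrite h1 !indic_l.
  by rewrite h2 !indic_r.
have ir : pull (dr d) (indic d') = indic b.
  apply/ffunP; apply: (@decomp_cover _ _ _ b) => i; rewrite ffunE.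
    by rewrite h3 !indic_l.
  by rewrite h4 !indic_r.
rewrite face_prod il ir (gp_factor a gp) (gp_factor b gq).
exact: prod_set_swap.
Qed.

Lemma face_natural I S T J S' T' (d : decomp I S T) (d' : decomp J S' T')
    (f : bijection I J) (g : bijection S S') (h : bijection T T')
    (p : set (vec R I)) :
  generalized_permutahedron p ->
  (forall s, f (dl d s) = dl d' (g s)) ->
  (forall t, f (dr d t) = dr d' (h t)) ->
  face_restr d' (relabel_set f p) = relabel_set g (face_restr d p) /\
  face_contr d' (relabel_set f p) = relabel_set h (face_contr d p).
Proof.
move=> gp hg hh; apply: gp_factor_unique; first exact: (gp_relabel f gp).1.
rewrite face_relabel -(relabel_prod_set _ _ hg hh) -(gp_factor d gp).
congr (relabel_set f (face p _)); apply/ffunP.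
apply: (@decomp_cover _ _ _ d) => i; rewrite ffunE.
  by rewrite hg !indic_l.
by rewrite hh !indic_r.
Qed.

Lemma pull_id I (f : I -> I) (x : vec R I) : (forall i, f i = i) -> pull f x = x.
Proof. by move=> h; apply/ffunP => i; rewrite ffunE h. Qed.

Definition gp_type I := {p : set (vec R I) | generalized_permutahedron p}.

Lemma gp_type_eq I (p q : gp_type I) : sval p = sval q -> p = q.
Proof. by case: p q => p hp [q hq] /= E; apply: eq_exist. Qed.

Definition gp_relabel_op I J (s : bijection I J) (p : gp_type I) : gp_type J :=
  exist _ _ (gp_relabel s (svalP p)).
Definition gp_mul_op I S T (d : decomp I S T) (p : gp_type S) (q : gp_type T) :
  gp_type I := exist _ _ (gp_prod d (svalP p) (svalP q)).
Definition gp_restr_op I S T (d : decomp I S T) (p : gp_type I) : gp_type S :=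
  exist _ _ (gp_restr d (svalP p)).
Definition gp_contr_op I S T (d : decomp I S T) (p : gp_type I) : gp_type T :=
  exist _ _ (gp_contr d (svalP p)).

Definition GP : hopfMonoid gp_type.
Proof.
exists gp_relabel_op (exist _ _ gp_void) gp_mul_op gp_restr_op gp_contr_op.
- move=> I s x h; apply: gp_type_eq; apply/seteqP.
  by split=> u; rewrite /gp_relabel_op /relabel_set /= pull_id.
- move=> I J K s t r x h; apply: gp_type_eq; apply/seteqP.
  have e u : pull s (pull t u) = pull r u.
    by apply/ffunP => i; rewrite !ffunE h.
  by split=> u; rewrite /gp_relabel_op /relabel_set /= e.
- move=> x; apply: gp_type_eq => /=; apply/seteqP; split=> // u _.
  have [[[v xv] _] _] := svalP x.
  by rewrite (_ : u = v) //; apply/ffunP => -[].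
- move=> I S T J S' T' d d' f g h x y hg hh; apply: gp_type_eq.
  exact: relabel_prod_set.
- move=> I S T J S' T' d d' f g h z hg hh; apply: gp_type_eq; apply/esym.
  exact: (face_natural (svalP z) hg hh).1.
- move=> I S T J S' T' d d' f g h z hg hh; apply: gp_type_eq; apply/esym.
  exact: (face_natural (svalP z) hg hh).2.
- move=> I d x h; apply: gp_type_eq; apply/seteqP.
  by split=> u; rewrite /gp_mul_op /prod_set /= pull_id // => -[].
- move=> I d x h; apply: gp_type_eq; apply/seteqP.
  by split=> u; rewrite /gp_mul_op /prod_set /= pull_id // => -[].
- move=> I d x h; apply: gp_type_eq; rewrite /gp_restr_op /= /face_restr.
  rewrite (gp_full d (svalP x)) //; apply/seteqP; split=> u.
    by move=> [v xv <-]; rewrite pull_id.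
  by move=> xu; exists u; rewrite ?pull_id.
- move=> I d x h; apply: gp_type_eq; rewrite /gp_contr_op /= /face_contr.
  rewrite (_ : indic d = 0) ?face0; last first.
    by apply/ffunP => i; rewrite -{1}[i]h indic_r ffunE.
  apply/seteqP; split=> u; first by move=> [v xv <-]; rewrite pull_id.
  by move=> xu; exists u; rewrite ?pull_id.
- move=> I Q S T U V d1 d2 d3 d4 x y z h1 h2 h3; apply: gp_type_eq.
  exact: prod_set_assoc.
- move=> I Q S T U V d1 d2 d3 d4 w h1 h2 h3; apply: gp_type_eq.
  by have [] := face_coassoc (svalP w) h1 h2 h3.
- move=> I Q S T U V d1 d2 d3 d4 w h1 h2 h3; apply: gp_type_eq.
  by have [] := face_coassoc (svalP w) h1 h2 h3.
- move=> I Q S T U V d1 d2 d3 d4 w h1 h2 h3; apply: gp_type_eq.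
  by have [] := face_coassoc (svalP w) h1 h2 h3.
- move=> I S T S' T' A B C D d d' a b a' b' x y h1 h2 h3 h4.
  apply: gp_type_eq.
  exact: (face_compat (svalP x) (svalP y) h1 h2 h3 h4).1.
- move=> I S T S' T' A B C D d d' a b a' b' x y h1 h2 h3 h4.
  apply: gp_type_eq.
  exact: (face_compat (svalP x) (svalP y) h1 h2 h3 h4).2.
Defined.
End Polytopes.

(* Main.v *)
Require Import Defs.
From mathcomp Require Import all_boot all_order all_algebra.
From mathcomp Require Import boolp classical_sets reals.
From mathcomp Require Import lra.

Set Implicit Arguments.
Unset Strict Implicit.
Unset Printing Implicit Defensive.

Import Order.TTheory GRing.Theory Num.Theory.
Local Open Scope classical_set_scope.
Local Open Scope ring_scope.

(** By [gpP], a polytope p is a generalized permutahedron as soon as p_y is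
    contained in p_y' whenever y' weakly respects the order in which y ranks
    the coordinates. The Hopf structure gives this through coassociativity.

    For sets V contained in W, coassociativity says that the two ways of cutting
    p along V and W agree; in terms of faces, (p_{1_V})_{1_W} and
    (p_{1_W})_{1_V} are the same product of three polytopes
    ([face_face_indicator_comm]). Since a face p_{1_V} is a product of elements
    of P, it is again in P, so that the argument can be iterated: for a chain of
    sets, the faces p_{1_V} have a common point ([chain_faces_meet]).

    Now list the coordinates by decreasing y. The prefixes of the list form a
    chain; let x0 be in all the corresponding faces. By summation by parts, a
    functional that decreases along the list is a nonnegative combination of
    the indicators of the prefixes, up to a multiple of 1_I. Unitality makes 1_I
    constant on p, so x0 maximizes all functionals in the closed braid cone of
    y at once ([braid_cone_common_maximizer]). Finally, y is in the relative
    interior of this cone, so that c y - y' is still in the cone for large c,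
    and c y = (c y - y') + y' is a sum of two functionals with a common
    maximizer x0: maximizing the sum forces maximizing y'
    ([face_sub_of_common_maximizer]).

    Given this, the inclusion into GP respects the coproducts because a nonempty
    product determines its factors. *)

(** * Indicator functionals and faces in braid directions *)

Section Faces.
Variable R : realType.

Definition indicator (I : finType) (s : seq I) : vec R I :=
  [ffun i => (i \in s)%:R].

Lemma dot_indicator (I : finType) (s : seq I) (x : vec R I) :
  uniq s -> dot (indicator s) x = \sum_(i <- s) x i.
Proof.
move=> us; transitivity (\sum_(i in s) x i : R); last by rewrite big_uniq.
rewrite big_mkcond /=.
by apply: eq_bigr => i _; rewrite ffunE; case: (i \in s); rewrite ?mul1r ?mul0r.
Qed.

(** Parts of I are subtypes while a part of a part must again be a part of I;
    realizing all of them through injections e into I makes the inclusions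
    commute, as the axioms of a Hopf monoid require. *)
Lemma decomp_of_seqs (I X : finType) (e : X -> I) (s t : seq I) :
  injective e -> (forall i, (i \in codom e) = (i \in s) || (i \in t)) ->
  (forall i, i \in s -> i \notin t) ->
  exists d : decomp X {i | i \in s} {i | i \in t},
    (forall a, e (dl d a) = sval a) /\ (forall b, e (dr d b) = sval b).
Proof.
move=> eI eST dis.
pose v (o : {i | i \in s} + {i | i \in t}) : I :=
  match o with inl a => sval a | inr b => sval b end.
have /choice[g gP] : forall o, exists x, e x = v o.
  move=> o; suff /codomP[x ->] : v o \in codom e by exists x.
  by case: o => -[i ii]; rewrite eST /= ii ?orbT.
have /choice[h hP] : forall x, exists o, v o = e x.
  move=> x; have := codom_f e x; rewrite eST => /orP[xs|xt].
    by exists (inl (Sub (e x) xs)).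
  by exists (inr (Sub (e x) xt)).
have vI : injective v.
  move=> [[a aS]|[a aT]] [[b bS]|[b bT]] /= E; subst b.
  - by rewrite (bool_irrelevance aS bS).
  - by have := dis _ aS; rewrite bT.
  - by have := dis _ bS; rewrite aT.
  - by rewrite (bool_irrelevance aT bT).
have gB : bijective g.
  by exists h => [o|x]; [apply: vI; rewrite hP | apply: eI; rewrite gP].
by exists (Bijection gB); split=> ?; rewrite [LHS]gP.
Qed.

Lemma indic_indicator (I S T : finType) (d : decomp I S T) (s : seq I) :
  (forall a, dl d a \in s) -> (forall b, dr d b \notin s) ->
  indic R d = indicator s.
Proof.
move=> ls rs; apply/ffunP; apply: (decomp_cover (d := d)) => i.
  by rewrite indic_l ffunE ls.
by rewrite indic_r ffunE (negPf (rs i)).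
Qed.

Lemma faceZ (I : finType) (p : set (vec R I)) y c :
  0 < c -> face p (c *: y) = face p y.
Proof.
move=> c0; apply/seteqP; split=> x [px xm]; split=> // z pz.
  by have := xm _ pz; rewrite !dotZl ler_pM2l.
by rewrite !dotZl ler_pM2l // xm.
Qed.

(** The maximum of u + v over p is the sum of the two maxima, by x0; hence it is
    reached only where both are. *)
Lemma face_sub_of_common_maximizer (I : finType) (p : set (vec R I)) u v x0 :
  face p u x0 -> face p v x0 -> face p (u + v) `<=` face p v.
Proof.
move=> [px0 um] [_ vm] x [px xm]; split=> // z pz.
have := xm _ px0; have := um _ px; have := vm _ pz; rewrite !dotDl; lra.
Qed.

(** Summation by parts, by induction from the end of the list: the bound c
    stands for the value of z just after the last entry, and removing the last
    entry a replaces c by z a, which splits off (z a - c) times a prefix sum of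
    w, a nonnegative term. *)
Lemma sum_by_parts_ge (I : eqType) (s : seq I) (z w : I -> R) (c : R) :
  pairwise (fun i j => z j <= z i) s -> all (fun i => c <= z i) s ->
  (forall t, prefix t s -> 0 <= \sum_(i <- t) w i) ->
  c * (\sum_(i <- s) w i) <= \sum_(i <- s) z i * w i.
Proof.
elim/last_ind: s c => [|s a IH] c; first by rewrite !big_nil mulr0.
rewrite pairwise_rcons all_rcons => /andP[za zs] /andP[ca _] wp.
have ws : 0 <= \sum_(i <- rcons s a) w i by apply: wp; exact: prefix_refl.
have {}IH : z a * (\sum_(i <- s) w i) <= \sum_(i <- s) z i * w i.
  apply: IH => // t ts; apply: wp; apply: prefix_trans ts _.
  exact: prefix_rcons.
apply: le_trans (ler_wpM2r ws ca) _.
by rewrite -!cats1 !big_cat !big_seq1 /= mulrDr lerD2r.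
Qed.

(** Where y has a tie, y' has it too; where y has a strict inequality, c y
    dominates y' once c exceeds the finitely many slopes of y' against y. *)
Lemma braid_face_interior (I : finType) (y y' : vec R I) :
  braid_face y y' -> exists2 c, 0 < c & braid_face y (c *: y - y').
Proof.
move=> yy'.
pose slope : vec R (I * I)%type :=
  [ffun ij => (y' ij.2 - y' ij.1) / (y ij.2 - y ij.1)].
have [c c0 cb] := vec_bound slope; exists c => // i j; rewrite le_eqVlt.
have E k : (c *: y - y') k = c * y k - y' k by rewrite !ffunE.
rewrite !{}E; move=> /orP[/eqP yE|lt_y].
  have e : y' i = y' j by apply/eqP; rewrite eq_le !yy' ?yE.
  by rewrite yE e.
have d0 : 0 < y j - y i by rewrite subr_gt0.
have := le_lt_trans (ler_norm _) (cb (i, j)); rewrite ffunE /=.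
by rewrite ltr_pdivrMr // mulrBr; lra.
Qed.

End Faces.

Arguments indicator {R I} s.

(** * Faces of the polytopes of a Hopf monoid *)

Section PolytopeHopfMonoid.
Variables (R : realType) (P : forall I : finType, set (set (vec R I))).
Hypothesis P_polytope :
  forall (I : finType) (p : set (vec R I)), P p -> polytope p.
Variable M : hopfMonoid (fun I : finType => {p : set (vec R I) | P p}).
Hypothesis M_product : forall (I S T : finType) (d : decomp I S T)
    (p : {p : set (vec R S) | P p}) (q : {q : set (vec R T) | P q}),
  sval (hm_mul M d p q) = prod_set d (sval p) (sval q).
Hypothesis M_coproduct : forall (I S T : finType) (d : decomp I S T)
    (p : {p : set (vec R I) | P p}),
  face (sval p) (indic R d) =
  prod_set d (sval (hm_restr M d p)) (sval (hm_contr M d p)).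

Lemma face_indicator_in (I : finType) (p : set (vec R I)) (s : seq I) :
  P p -> P (face p (indicator s)).
Proof.
move=> Pp.
have [| |i|d [dlE drE]] :=
    @decomp_of_seqs I I id s [seq i <- enum I | i \notin s].
- by [].
- by move=> i; rewrite mem_filter mem_enum andbT orbN (codom_f id).
- by rewrite mem_filter negb_and negbK => ->.
rewrite -(@indic_indicator _ _ _ _ d).
- rewrite (M_coproduct d (exist _ p Pp)) -M_product; exact: svalP.
- by move=> a; rewrite [dl d a]dlE; exact: (svalP a).
- move=> b; rewrite [dr d b]drE.
  by have := svalP b; rewrite mem_filter => /andP[].
Qed.

(** Coassociativity read on faces: along either order of cutting, the iterated
    face is the same product of three polytopes. *)
Lemma face_face_indic_comm (I Q S T U V : finType)
    (d1 : decomp I Q U) (d2 : decomp U S T)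
    (d3 : decomp I V T) (d4 : decomp V Q S) (p : set (vec R I)) :
  P p ->
  (forall r, dl d1 r = dl d3 (dl d4 r)) ->
  (forall s, dr d1 (dl d2 s) = dl d3 (dr d4 s)) ->
  (forall t, dr d1 (dr d2 t) = dr d3 t) ->
  face (face p (indic R d1)) (indic R d3) =
  face (face p (indic R d3)) (indic R d1).
Proof.
move=> Pp h1 h2 h3.
have l31 : pull (dl d3) (indic R d1) = indic R d4.
  apply/ffunP; apply: (decomp_cover (d := d4)) => i; rewrite ffunE.
    by rewrite -h1 !indic_l.
  by rewrite -h2 !indic_r.
have r31 : pull (dr d3) (indic R d1) = 0.
  by apply/ffunP => t; rewrite ffunE -h3 indic_r ffunE.
have dE i : (indic R d3 + (-1) *: indic R d1) i = indic R d3 i - indic R d1 i.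
  by rewrite ffunE [X in _ + X]ffunE [_ *: _]mulN1r.
have l13 : pull (dl d1) (indic R d3 + (-1) *: indic R d1) = 0.
  by apply/ffunP => r; rewrite ffunE dE indic_l h1 indic_l subrr ffunE.
have r13 : pull (dr d1) (indic R d3 + (-1) *: indic R d1) = indic R d2.
  apply/ffunP; apply: (decomp_cover (d := d2)) => i; rewrite ffunE dE indic_r.
    by rewrite h2 !indic_l subr0.
  by rewrite h3 !indic_r subr0.
(* On p_{1_Q} the functional 1_Q is constant, so 1_V may be replaced by
   1_V - 1_Q, which vanishes on the first factor. *)
rewrite -(face_shift p (indic R d1) _ (-1)).
rewrite !(M_coproduct _ (exist _ p Pp)) !face_prod.
rewrite l31 r31 l13 r13 !face0 !M_coproduct.
rewrite (prod_set_assoc _ _ _ h1 h2 h3).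
by rewrite (restr_restr M _ h1 h2 h3) (contr_restr M _ h1 h2 h3)
  -(contr_contr M _ h1 h2 h3).
Qed.

Lemma face_face_indicator_comm (I : finType) (p : set (vec R I)) (s t : seq I) :
  P p -> {subset s <= t} ->
  face (face p (indicator s)) (indicator t) =
  face (face p (indicator t)) (indicator s).
Proof.
move=> Pp st.
(* I is split into s, ts and nt; ns is the union of the last two. *)
pose ns := [seq i <- enum I | i \notin s].
pose nt := [seq i <- enum I | i \notin t].
pose ts := [seq i <- t | i \notin s].
have nsE i : (i \in ns) = (i \notin s) by rewrite mem_filter mem_enum andbT.
have ntE i : (i \in nt) = (i \notin t) by rewrite mem_filter mem_enum andbT.
have tsE i : (i \in ts) = (i \notin s) && (i \in t) by rewrite mem_filter.
have cod (r : seq I) i : (i \in codom (sval : {i | i \in r} -> I)) = (i \in r).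
  by apply/codomP/idP => [[x ->]|ir]; [exact: (svalP x) | exists (Sub i ir)].
have sI (r : seq I) : injective (sval : {i | i \in r} -> I) by exact: val_inj.
have idI : injective (@id I) by [].
have [| |d1 [l1 r1]] := @decomp_of_seqs I I id s ns idI.
- by move=> i; rewrite nsE orbN (codom_f id).
- by move=> i; rewrite nsE negbK.
have [| |d3 [l3 r3]] := @decomp_of_seqs I I id t nt idI.
- by move=> i; rewrite ntE orbN (codom_f id).
- by move=> i; rewrite ntE negbK.
have [| |d2 [l2 r2]] := @decomp_of_seqs I _ _ ts nt (sI ns).
- move=> i; rewrite cod nsE tsE ntE.
  by have := st i; do 2 case: (i \in _) => //; move=> /(_ isT).
- by move=> i; rewrite tsE ntE negbK => /andP[].
have [| |d4 [l4 r4]] := @decomp_of_seqs I _ _ s ts (sI t).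
- move=> i; rewrite cod tsE.
  by have := st i; do 2 case: (i \in _) => //; move=> /(_ isT).
- by move=> i is_; rewrite tsE is_.
rewrite -(@indic_indicator _ _ _ _ d1); first last.
- by move=> b; rewrite [dr d1 b]r1 -nsE; exact: (svalP b).
- by move=> a; rewrite [dl d1 a]l1; exact: (svalP a).
rewrite -(@indic_indicator _ _ _ _ d3); first last.
- by move=> b; rewrite [dr d3 b]r3 -ntE; exact: (svalP b).
- by move=> a; rewrite [dl d3 a]l3; exact: (svalP a).
apply: (@face_face_indic_comm _ _ _ _ _ _ d1 d2 d3 d4) => // i.
- by rewrite [LHS]l1 [RHS]l3 l4.
- by rewrite [LHS]r1 [RHS]l3 r4 l2.
- by rewrite [LHS]r1 [RHS]r3 r2.
Qed.

(** The face in the direction of the longest prefix is again in P, and commuting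
    faces carries its own common point, found by induction, back to p. *)
Lemma chain_faces_meet (I : finType) (s : seq I) (p : set (vec R I)) :
  P p ->
  exists x0, forall t, prefix t s -> face p (indicator t) x0.
Proof.
elim/last_ind: s p => [|s a IH] p Pp.
  have [[x px] _] := P_polytope Pp; exists x => t.
  rewrite prefixs0 => /eqP->.
  have -> : indicator [::] = 0 :> vec R I by apply/ffunP => i; rewrite !ffunE.
  by rewrite face0.
have [x0 Hx0] := IH _ (face_indicator_in (rcons s a) Pp).
exists x0 => t /prefixP[u]; case/lastP: u => [|u b].
  by rewrite cats0 => <-; have [] := Hx0 _ (prefix0s s).
rewrite -rcons_cat => /rcons_inj[sE _].
have /Hx0 : prefix t s by rewrite sE prefix_prefix.
rewrite -face_face_indicator_comm // => [|i it]; first by case.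
by rewrite mem_rcons inE sE mem_cat it !orbT.
Qed.

(** Unitality: p_{1_I} = p, so that p lies in a hyperplane where the sum of the
    coordinates is constant. *)
Lemma sum_coord_const (I : finType) (p : set (vec R I)) x x' :
  P p -> p x -> p x' -> \sum_i x i = \sum_i x' i.
Proof.
move=> Pp.
pose f (o : I + void) : I :=
  match o with inl i => i | inr v => match v with end end.
have fB : bijective f by exists inl => [[|[]]|].
pose d : decomp I I void := Bijection fB.
have dE i : dl d i = i by [].
have full : face p (indic R d) = p.
  rewrite (M_coproduct d (exist _ p Pp)) -M_product.
  by rewrite (restr_full M) // (one_unique M (hm_contr _ _ _)) mul_one.
have dot1 z : dot (indic R d) z = \sum_i z i.
  by apply: eq_bigr => i _; rewrite -[in indic _ _ _](dE i) indic_l mul1r.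
rewrite -full => -[px xm] [px' xm'].
by apply/eqP; rewrite eq_le -!dot1 xm ?xm'.
Qed.

Lemma braid_cone_common_maximizer (I : finType) (p : set (vec R I)) y :
  P p -> exists x0, forall z, braid_face y z -> face p z x0.
Proof.
move=> Pp; pose ge_y i j := y j <= y i.
pose s := sort ge_y (enum I).
have us : uniq s by rewrite sort_uniq enum_uniq.
have ms i : i \in s by rewrite mem_sort mem_enum.
have ys : pairwise ge_y s.
  rewrite -sorted_pairwise; last by move=> j i k /[swap]; exact: le_trans.
  by apply: sort_sorted => i j; exact: le_total.
have [x0 Hx0] := chain_faces_meet s Pp.
have px0 : p x0 by have [] := Hx0 _ (prefix0s s).
have sums (F : I -> R) : \sum_(i <- s) F i = \sum_i F i.
  by rewrite big_uniq //=; apply: eq_bigl => i; rewrite ms.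
exists x0 => z yz; split=> // x px.
(* Each prefix sum of x0 - x is nonnegative, as x0 maximizes the indicator of
   the prefix; the full sum vanishes. *)
have zs : pairwise (fun i j => z j <= z i) s.
  by apply: sub_pairwise ys => i j; exact: yz.
have wp t : prefix t s -> 0 <= \sum_(i <- t) (x0 i - x i).
  move=> ts; have ut : uniq t.
    by move: ts us => /prefixP[u ->]; rewrite cat_uniq => /andP[].
  by rewrite sumrB subr_ge0 -!dot_indicator //; exact: (Hx0 _ ts).2.
have [c _ cz] := vec_bound z.
have cs : all (fun i => - c <= z i) s.
  by apply/allP => i _; have := cz i; rewrite ltr_norml => /andP[/ltW].
have := sum_by_parts_ge zs cs wp; rewrite !sums sumrB.
rewrite (sum_coord_const Pp px0 px) subrr mulr0.
under eq_bigr do rewrite mulrBr.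
by rewrite sumrB subr_ge0.
Qed.

Lemma generalized_permutahedron_of_hopf (I : finType) (p : set (vec R I)) :
  P p -> generalized_permutahedron p.
Proof.
move=> Pp; apply/gpP; split; first exact: P_polytope.
move=> y y' yy'.
have [x0 Hx0] := braid_cone_common_maximizer y Pp.
have [c c0 cyy'] := braid_face_interior yy'.
rewrite -(faceZ p y c0) -(subrK y' (c *: y)).
by apply: face_sub_of_common_maximizer; exact: Hx0.
Qed.

End PolytopeHopfMonoid.

(** * Inclusion into generalized permutahedra *)

Theorem theorem6p1 (R : realType)
    (P : forall I : finType, set (set (vec R I)))
    (P_polytope : forall (I : finType) (p : set (vec R I)), P I p -> polytope p)
    (M : hopfMonoid (fun I : finType => {p : set (vec R I) | P I p}))
    (M_relabel : forall (I J : finType) (s : bijection I J)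
        (p : {p : set (vec R I) | P I p}),
      sval (hm_relabel M s p) = relabel_set s (sval p))
    (M_product : forall (I S T : finType) (d : decomp I S T)
        (p : {p : set (vec R S) | P S p}) (q : {q : set (vec R T) | P T q}),
      sval (hm_mul M d p q) = prod_set d (sval p) (sval q))
    (M_coproduct : forall (I S T : finType) (d : decomp I S T)
        (p : {p : set (vec R I) | P I p}),
      face (sval p) (indic R d) =
      prod_set d (sval (hm_restr M d p)) (sval (hm_contr M d p))) :
  exists P_gp : forall (I : finType) (p : set (vec R I)),
      P I p -> generalized_permutahedron p,
    hopf_submonoid M (GP R)
      (fun (I : finType) (p : {p : set (vec R I) | P I p}) =>
         exist _ (sval p) (P_gp I (sval p) (svalP p))).
Proof.
have P_gp := generalized_permutahedron_of_hopf P_polytope M_product M_coproduct.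
exists P_gp; split=> [I [p Pp] [q Pq] [pq]|].
  exact: eq_exist.
split=> [I J f x|I S T d x y|I S T d z|I S T d z]; apply: gp_type_eq => /=.
- exact: M_relabel.
- exact: M_product.
- have zP := P_polytope _ _ (svalP z).
  by have [] := gp_factor_unique zP (M_coproduct _ _ _ d z).
- have zP := P_polytope _ _ (svalP z).
  by have [] := gp_factor_unique zP (M_coproduct _ _ _ d z).
Qed.
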